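(* Let $\alpha\in(0,1)$, let $M$ be a differentiable manifold of dimension $n$, let $\mathop{H}\limits^{\alpha}$ be a fractional dynamical connection on $J^{\alpha}(\mathbb{R},M)$, let $U$ be a chart of $M$ and $W=(\pi_0^{\alpha})^{-1}(U)$ the corresponding chart of $J^{\alpha}(\mathbb{R},M)$ with coordinates $(t,x^i,y^{i(\alpha)})$. Then (with summation over repeated indices): (a) In the chart $W$ the connection is given by $$\mathop{H}\limits^{\alpha}=\frac{1}{\Gamma(1+\alpha)}\Big[\big(-y^{i(\alpha)}D^{\alpha}_{x^i}+H^iD^{\alpha}_{y^{i(\alpha)}}\big)\otimes d(t)^{\alpha}+\big(D^{\alpha}_{x^i}+H_i^jD^{\alpha}_{y^{j(\alpha)}}\big)\otimes d(x^i)^{\alpha}-D^{\alpha}_{y^{i(\alpha)}}\otimes d(y^{i(\alpha)})^{\alpha}\Big]$$ for some functions $H^i,H_i^j$ on $W$, $i,j=1,\dots,n$. (b) $\mathop{H}\limits^{\alpha}$ defines an $f(3,-1)$ fractional structure on $J^{\alpha}(\mathbb{R},M)$, i.e. $\big(\mathop{H}\limits^{\alpha}\big)^3=\mathop{H}\limits^{\alpha}$. (c) The fractional tensor fields $\mathop{l}\limits^{\alpha}=\mathop{H}\limits^{\alpha}\circ\mathop{H}\limits^{\alpha}$ and $\mathop{m}\limits^{\alpha}=-\mathop{H}\limits^{\alpha}\circ\mathop{H}\limits^{\alpha}+I$, where $I$ is the identity map, satisfy $$\mathop{l}\limits^{\alpha}\circ\mathop{l}\limits^{\alpha}=\mathop{l}\limits^{\alpha},\quad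 \mathop{m}\limits^{\alpha}\circ\mathop{m}\limits^{\alpha}=\mathop{m}\limits^{\alpha},\quad \mathop{m}\limits^{\alpha}\circ\mathop{l}\limits^{\alpha}=0,\quad \mathop{l}\limits^{\alpha}+\mathop{m}\limits^{\alpha}=I,$$ $$\mathop{l}\limits^{\alpha}(D_t^{\alpha})=-y^{i(\alpha)}D^{\alpha}_{x^i}-\big(y^{i(\alpha)}H_i^j+H^j\big)D^{\alpha}_{y^{j(\alpha)}},\quad \mathop{l}\limits^{\alpha}(D^{\alpha}_{x^i})=D^{\alpha}_{x^i},\quad \mathop{l}\limits^{\alpha}(D^{\alpha}_{y^{i(\alpha)}})=D^{\alpha}_{y^{i(\alpha)}},$$ $$\mathop{m}\limits^{\alpha}(D_t^{\alpha})=D_t^{\alpha}+y^{i(\alpha)}D^{\alpha}_{x^i}+\big(y^{i(\alpha)}H_i^j+H^j\big)D^{\alpha}_{y^{j(\alpha)}},\quad \mathop{m}\limits^{\alpha}(D^{\alpha}_{x^i})=0,\quad \mathop{m}\limits^{\alpha}(D^{\alpha}_{y^{i(\alpha)}})=0.$$ (d) The fractional vector field $$\mathop{\Gamma}\limits^{\alpha}=\mathop{m}\limits^{\alpha}(D_t^{\alpha})=D_t^{\alpha}+y^{i(\alpha)}D^{\alpha}_{x^i}+\big(y^{i(\alpha)}H_i^j+H^j\big)D^{\alpha}_{y^{j(\alpha)}}$$ is a field FODE (associated to the fractional dynamical connection), and its integral curves are the solutions of the fractional differential equations $$D_t^{2\alpha}x^j(t)=D_t^{\alpha}x^i(t)\,H_i^j+\Gamma(1+\alpha)H^j,\qquad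 j=1,\dots,n,$$ where $H_i^j$ and $H^j$ are evaluated at $(t,x(t),y^{(\alpha)}(t))$ with $y^{i(\alpha)}(t)=\frac{1}{\Gamma(1+\alpha)}D_t^{\alpha}x^i(t)$.
   Context: $\Gamma(\cdot)$ (with a numerical argument) is Euler's gamma function. For a function $f$ on an interval with left endpoint $a$, $(D_t^{\alpha}f)(t)=\frac{1}{\Gamma(1-\alpha)}\frac{d}{dt}\int_a^t\frac{f(s)-f(a)}{(t-s)^{\alpha}}\,ds$, and $D_t^{2\alpha}=D_t^{\alpha}D_t^{\alpha}$. Two curves in $M$ through $x_0$ at $t=0$ have fractional contact $\alpha$ of order 1 at $x_0$ if $D_t^{\alpha}(f\circ\rho)|_{t=0}=D_t^{\alpha}(f\circ\sigma)|_{t=0}$ for all functions $f$ on a chart around $x_0$; the set of all equivalence classes, over all $x_0\in M$, is $Osc^{\alpha}(M)$. Put $J^{\alpha}(\mathbb{R},M)=\mathbb{R}\times Osc^{\alpha}(M)$, with projection $\pi_0^{\alpha}$ to $M$. A chart $U$ of $M$ with coordinates $(x^i)$ induces on $W=(\pi_0^{\alpha})^{-1}(U)$ the coordinates $(t,x^i,y^{i(\alpha)})$, where for the class of a curve $x^i(t)$ one has $y^{i(\alpha)}=\frac{1}{\Gamma(1+\alpha)}D_t^{\alpha}x^i(t)|_{t=0}$. On $W$, $D_t^{\alpha},D_{x^i}^{\alpha},D_{y^{i(\alpha)}}^{\alpha}$ denote the partial fractional derivative operators of order $\alpha$ in the indicated variables. The space $\chi^{\alpha}(W)$ of fractional vector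 fields is generated by them over the functions on $W$, with these operators as a basis. The fractional 1-forms are generated by $d(t)^{\alpha},d(x^i)^{\alpha},d(y^{i(\alpha)})^{\alpha}$ and act linearly over functions on $\chi^{\alpha}(W)$ so that $\frac{1}{\Gamma(1+\alpha)}d(t)^{\alpha},\frac{1}{\Gamma(1+\alpha)}d(x^i)^{\alpha},\frac{1}{\Gamma(1+\alpha)}d(y^{i(\alpha)})^{\alpha}$ is the basis dual to $D_t^{\alpha},D_{x^i}^{\alpha},D_{y^{i(\alpha)}}^{\alpha}$. A fractional tensor field of type $(1,1)$ is (in each chart $W$) a function-linear endomorphism of $\chi^{\alpha}(W)$; a tensor product of a 1-form $\omega$ and a fractional vector field $X$, written in either order, denotes the endomorphism $Z\mapsto\omega(Z)X$, and $\circ$ is composition of endomorphisms. Set $\mathop{\theta^i}\limits^{\alpha}=\frac{1}{\Gamma(1+\alpha)}\big(d(x^i)^{\alpha}-y^{i(\alpha)}d(t)^{\alpha}\big)$, $\mathop{\theta_1}\limits^{\alpha}=d(t)^{\alpha}\otimes\big(D_t^{\alpha}+y^{i(\alpha)}D_{x^i}^{\alpha}\big)$, $\mathop{\theta_2}\limits^{\alpha}=\mathop{\theta^i}\limits^{\alpha}\otimes D_{x^i}^{\alpha}$, and let $\mathop{V}\limits^{\alpha}$ be the submodule generated by $D^{\alpha}_{y^{i(\alpha)}}$, $i=1,\dots,n$. A fractional dynamical connection on $J^{\alpha}(\mathbb{R},M)$ is a fractional tensor field $\mathop{H}\limits^{\alpha}$ of type $(1,1)$ with $\mathop{\theta_1}\limits^{\alpha}\circ\mathop{H}\limits^{\alpha}=0$,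 $\mathop{\theta_2}\limits^{\alpha}\circ\mathop{H}\limits^{\alpha}=\mathop{\theta_2}\limits^{\alpha}$ and $\mathop{H}\limits^{\alpha}|_{\mathop{V}\limits^{\alpha}}=-\mathrm{id}|_{\mathop{V}\limits^{\alpha}}$. A fractional vector field $X$ is called FODE (fractional ordinary differential equation) if $\frac{1}{\Gamma(1+\alpha)}d(t)^{\alpha}(X)=1$ and $\mathop{\theta^i}\limits^{\alpha}(X)=0$ for all $i$; equivalently, $X=D_t^{\alpha}+y^{i(\alpha)}D_{x^i}^{\alpha}+F^iD^{\alpha}_{y^{i(\alpha)}}$ locally. Its integral curves are the curves $x^i(t)$ such that, with $y^{i(\alpha)}(t)=\frac{1}{\Gamma(1+\alpha)}D_t^{\alpha}x^i(t)$, one has $D_t^{\alpha}y^{i(\alpha)}(t)=F^i(t,x(t),y^{(\alpha)}(t))$. *)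

(* Defs.v *)
From HB Require Import structures.
From mathcomp Require Export all_boot all_order all_algebra.
From mathcomp Require Export all_classical all_reals all_analysis.
Export Order.TTheory GRing.Theory Num.Theory.
Export numFieldNormedType.Exports.

Set Implicit Arguments.
Unset Strict Implicit.
Unset Printing Implicit Defensive.

#[export] Set Implicit Arguments.
#[export] Unset Strict Implicit.
#[export] Unset Printing Implicit Defensive.

Local Open Scope classical_set_scope.
Local Open Scope ring_scope.

Section FractionalDerivative.
Context {R : realType}.
Implicit Types (al a t : R) (f : R -> R).

Definition Gamma (z : R) : R :=
  \int[lebesgue_measure]_(t in `]0, +oo[) (t `^ (z - 1) * expR (- t)).

Definition frac_kernel al a f t (s : R) : R := (f s - f a) / (t - s) `^ al.

Definition frac_integral al a f t : R :=
  \int[lebesgue_measure]_(s in `[a, t]) frac_kernel al a f t s.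

(* The filter of increments h -> 0, h <> 0, keeping t + h in [a, +oo[: the
   derivative at the left endpoint t = a is the right derivative. *)
Definition increments a t : set_system R :=
  within [set h | a <= t + h] 0^'.

Definition frac_quotient al a f t (h : R) : R :=
  h^-1 * (frac_integral al a f (t + h) - frac_integral al a f t).

(* D_t^al f at t, for f given on an interval with left endpoint a.  Only the
   values of f on [a, t + e[ for small e > 0 are involved. *)
Definition fracD al a f t : R :=
  (Gamma (1 - al))^-1 * lim (frac_quotient al a f t @ increments a t).

Definition frac_derivable al a f t : Prop :=
  (\forall u \near t, a <= u ->
     lebesgue_measure.-integrable `[a, u] (EFin \o frac_kernel al a f u)) /\
  cvg (frac_quotient al a f t @ increments a t).

End FractionalDerivative.

Section Manifold.
Context {R : realType}.

Fixpoint Ck (V U : normedModType R) (k : nat) (A : set V) (f : V -> U) : Prop :=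
  (forall x, A x -> {for x, continuous f}) /\
  (if k is k'.+1 then
     forall v, (forall x, A x -> derivable f x v) /\
               Ck k' A (fun x => 'D_v f x)
   else True).

(* For A open. *)
Definition smooth_on (V U : normedModType R) (A : set V) (f : V -> U) : Prop :=
  forall k, Ck k A f.

End Manifold.

(* A C^oo manifold of dimension n with an arbitrary (possibly maximal) atlas;
   [inv c] matters only on the open set [crd c @` dom c]. *)
Record manifold (R : realType) (n : nat) := Manifold {
  points :> topologicalType;
  manifold_hausdorff : hausdorff_space points;
  manifold_second_countable : @second_countable points;
  chart : Type;
  dom : chart -> set points;
  crd : chart -> points -> 'rV[R]_n;
  inv : chart -> 'rV[R]_n -> points;
  dom_open : forall c, open (dom c);
  crd_open : forall c, open (crd c @` dom c);
  crdK : forall c p, dom c p -> inv c (crd c p) = p;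
  crd_continuous : forall c p, dom c p -> {for p, continuous (crd c)};
  inv_continuous : forall c z, (crd c @` dom c) z -> {for z, continuous (inv c)};
  chart_cover : forall p, exists c, dom c p;
  transition_smooth : forall c d,
    smooth_on (crd c @` (dom c `&` dom d)) (crd d \o inv c) }.

Arguments chart {R n} m.

Section Osculator.
Context {R : realType} {n : nat}.
Variables (al : R) (M : manifold R n).

Definition smooth_on_chart (c : chart M) (f : M -> R) : Prop :=
  smooth_on (crd c @` dom c) (f \o inv c).

(* Curves through rho 0 at t = 0, on an interval with left endpoint 0 (the
   values at t < 0 play no role): continuous, al-Hoelder at 0 and admitting
   derivatives of order al at 0 against smooth functions.  This is the class
   containing x^i(t) = x^i(0) + t^al y^i for which the order-al chain rule
   holds at t = 0, so that (t, x^i, y^i) below are coordinates. *)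
Definition is_curve (rho : R -> M) : Prop :=
  continuous rho /\
  forall (c : chart M) (f : M -> R), dom c (rho 0) -> smooth_on_chart c f ->
    (exists K, \forall t \near 0^'+, `|f (rho t) - f (rho 0)| <= K * t `^ al) /\
    frac_derivable al 0 (f \o rho) 0.

Definition curve := {rho : R -> M | is_curve rho}.

Definition frac_contact (rho sigma : curve) : Prop :=
  sval rho 0 = sval sigma 0 /\
  forall (c : chart M) (f : M -> R), dom c (sval rho 0) -> smooth_on_chart c f ->
    fracD al 0 (f \o sval rho) 0 = fracD al 0 (f \o sval sigma) 0.

Definition Osc := {A : set curve | exists rho, A = [set s | frac_contact rho s]}.

Definition Osc_repr (p : Osc) : R -> M := sval (projT1 (cid (svalP p))).

Definition J := (R * Osc)%type.

Definition pi0 (w : J) : M := Osc_repr w.2 0.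

End Osculator.

(* Labels of the 2n+1 coordinates (t, x^i, y^i) of a chart of J. *)
Definition var (n : nat) := option ('I_n + 'I_n)%type.

Section Coordinates.
Context {R : realType} {n : nat}.

Definition vt : var n := None.
Definition vx (i : 'I_n) : var n := Some (inl i).
Definition vy (i : 'I_n) : var n := Some (inr i).

Definition point_of (t : R) (x y : 'rV[R]_n) : var n -> R := fun k =>
  match k with
  | None => t
  | Some (inl i) => x 0 i
  | Some (inr i) => y 0 i
  end.

Definition subst (z : var n -> R) (k : var n) (s : R) : var n -> R :=
  fun k' => if k' == k then s else z k'.

End Coordinates.

Section Chart.
Context {R : realType} {n : nat}.
Variables (al : R) (M : manifold R n) (c : chart M).

Definition W := {w : J al M | dom c (pi0 w)}.

Definition coords (w : W) : var n -> R :=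
  point_of (sval w).1 (crd c (pi0 (sval w)))
    (\row_i ((Gamma (1 + al))^-1 *
             fracD al 0 (fun t => crd c (Osc_repr (sval w).2 t) 0 i) 0)).

Definition coord (k : var n) : W -> R := fun w => coords w k.

Definition coord_range : set (var n -> R) := range coords.

(* The value of a function on W at the point with coordinates z, and 0 when
   z is not in the coordinate range. *)
Definition at_coords (f : W -> R) (z : var n -> R) : R :=
  if pselect (exists w, coords w = z) is left e then f (projT1 (cid e)) else 0.

(* The function class is left open: any algebra of real functions on W that
   contains the coordinates, e.g. all functions or the smooth ones. *)
Definition function_algebra (S : set (W -> R)) : Prop :=
  [/\ forall r : R, S (cst r),
      forall f g, S f -> S g -> S (f + g),
      forall f g, S f -> S g -> S (f * g) &
      forall k, S (coord k)].

(* Left endpoints for the partial fractional derivatives: [lo k w] is the left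
   endpoint of an interval around the k-th coordinate of w inside the
   coordinate line through w.  It may depend on w since a coordinate line of
   W need not be an interval, or be unbounded below (as for t and y^i). *)
Definition left_endpoints (lo : var n -> W -> R) : Prop :=
  forall k w, lo k w < coord k w /\
    exists2 e, 0 < e & forall s, lo k w <= s < coord k w + e ->
      coord_range (subst (coords w) k s).

(* ^o: a left module over the ring of functions on W. *)
Definition operator := (W -> R) -> (W -> R)^o.
HB.instance Definition _ := GRing.Lmodule.on operator.

Definition partialD (lo : var n -> W -> R) (k : var n) : operator := fun f w =>
  fracD al (lo k w) (fun s => at_coords f (subst (coords w) k s)) (coord k w).

Section Tensors.
Variables (lo : var n -> W -> R) (S : set (W -> R)).

Local Notation D := (partialD lo).

Definition lin_comb (g : var n -> W -> R) : operator := \sum_k g k *: D k.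

Definition frac_fields : set operator :=
  [set X | exists2 g, (forall k, S (g k)) & X = lin_comb g].

Definition vertical : set operator :=
  [set X | exists2 g : 'I_n -> W -> R,
     (forall i, S (g i)) & X = \sum_i g i *: D (vy i)].

(* The k-th component of X in the basis D. *)
Definition component (k : var n) (X : operator) : W -> R :=
  xget (fun=> 0) [set g | X = lin_comb g] k.

(* d(t)^al, d(x^i)^al and d(y^i)^al: Gamma (1 + al) times the dual basis. *)
Definition d_form (k : var n) (X : operator) : W -> R :=
  cst (Gamma (1 + al)) * component k X.

Definition tensor (om : operator -> W -> R) (X : operator) :
  operator -> operator := fun Z => om Z *: X.

Definition tensor_field11 (H : operator -> operator) : Prop :=
  (forall X, frac_fields X -> frac_fields (H X)) /\
  (forall g X Y, S g -> frac_fields X -> frac_fields Y ->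
     H (g *: X + Y) = g *: H X + H Y).

Definition eq_tensor (H K : operator -> operator) : Prop :=
  forall X, frac_fields X -> H X = K X.

Definition theta (i : 'I_n) : operator -> W -> R := fun X =>
  cst (Gamma (1 + al))^-1 * (d_form (vx i) X - coord (vy i) * d_form vt X).

Definition theta1 : operator -> operator :=
  tensor (d_form vt) (D vt + \sum_i coord (vy i) *: D (vx i)).

Definition theta2 : operator -> operator :=
  \sum_i tensor (theta i) (D (vx i)).

Definition dynamical_connection_on (H : operator -> operator) : Prop :=
  [/\ tensor_field11 H,
      eq_tensor (theta1 \o H) 0,
      eq_tensor (theta2 \o H) theta2 &
      forall X, vertical X -> H X = - X].

Definition FODE (X : operator) : Prop :=
  [/\ frac_fields X,
      cst (Gamma (1 + al))^-1 * d_form vt X = 1 &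
      forall i, theta i X = 0].

End Tensors.

Section Curves.
Variables (a : R) (b : \bar R) (x : R -> 'rV[R]_n).

Definition chart_curve : Prop :=
  forall t, a <= t -> (t%:E < b)%E -> (crd c @` dom c) (x t).

Definition xcomp (j : 'I_n) (t : R) : R := x t 0 j.

Definition ycomp (j : 'I_n) (t : R) : R :=
  (Gamma (1 + al))^-1 * fracD al a (xcomp j) t.

Definition lift_point (t : R) : var n -> R := point_of t (x t) (\row_j ycomp j t).

(* The curve x^i(t), t in [a, b[, is an integral curve of
   X = D_t + y^i D_{x^i} + F^i D_{y^i}. *)
Definition integral_curve (lo : var n -> W -> R) (X : operator) : Prop :=
  chart_curve /\
  forall t, a <= t -> (t%:E < b)%E -> forall j,
    [/\ frac_derivable al a (xcomp j) t,
        frac_derivable al a (ycomp j) t &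
        fracD al a (ycomp j) t =
          at_coords (component lo (vy j) X) (lift_point t)].

(* D_t^{2 al} x^j = D_t^al x^i H1_i^j + Gamma (1 + al) H0^j on [a, b[. *)
Definition equation_solution (H0 : 'I_n -> W -> R)
    (H1 : 'I_n -> 'I_n -> W -> R) : Prop :=
  chart_curve /\
  forall t, a <= t -> (t%:E < b)%E -> forall j,
    [/\ frac_derivable al a (xcomp j) t,
        frac_derivable al a (fracD al a (xcomp j)) t &
        fracD al a (fracD al a (xcomp j)) t =
          \sum_i fracD al a (xcomp i) t * at_coords (H1 i j) (lift_point t)
          + Gamma (1 + al) * at_coords (H0 j) (lift_point t)].

End Curves.
End Chart.

Arguments coord {R n al M c} k _.
Arguments partialD {R n al M c} lo k _ _.
Arguments tensor {R n al M c} om X _.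
Arguments d_form {R n al M c} lo k X _.

Section Connection.
Context {R : realType} {n : nat}.
Variables (al : R) (M : manifold R n).
Variables (lo : forall c : chart M, var n -> W al c -> R).
Variables (S : forall c : chart M, set (W al c -> R)).

Definition dynamical_connection
    (H : forall c : chart M, operator al c -> operator al c) : Prop :=
  forall c, dynamical_connection_on (@lo c) (@S c) (H c).

Definition f31_structure
    (H : forall c : chart M, operator al c -> operator al c) : Prop :=
  forall c, tensor_field11 (@lo c) (@S c) (H c) /\
    eq_tensor (@lo c) (@S c) (H c \o H c \o H c) (H c).

End Connection.

(* Main.v *)
Require Import Defs.
From mathcomp Require Import measurable_realfun ring lra.

Local Open Scope classical_set_scope.
Local Open Scope ring_scope.

(** The theorem is linear algebra once the fractional partial derivatives are known
    to be linearly independent, and the independence is the analytic content.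

    Independence.  Vector fields act on all real functions of the chart, so one may
    test on an indicator function [bump] in one coordinate.  Let D_k be the
    derivative in that coordinate and lo the left endpoint used at the point w.
    Every other D_j sees a constant and gives 0 ([fracD_constant]); if the bump is
    1 on [b, d] with lo < b < d < x^k (w), then D_k gives
      ((x^k - b)^(-al) - (x^k - d)^(-al)) / Gamma (1 - al),
    which is nonzero ([fracD_bump], [partialD_bump]).  Hence coefficients are unique
    ([lin_comb_inj]).  That Gamma is finite and positive on ]0, 2[ ([Gamma_gt0])
    gives a nonzero factor 1 / Gamma (1 - al) here, and lets the factors
    Gamma (1 + al) in the dual basis cancel.

    Linear algebra.  With unique coefficients, theta1 o H = 0 says that H X has no
    t-component, theta2 o H = theta2 that its x^i-component is X^i - y^i X^t, and
    H is - id on vertical fields.  So H is known on the basis up to its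
    y^j-components H^j and H_i^j on D_t and D_(x^i) ([dynamical_connection_frame]);
    this is the normal form.  Squaring, H o H is the identity on fields without
    t-component ([squared_basis]).  As H X has none, H^3 = H ([connection_cubed]),
    and l = H o H, m = id - H o H are complementary projectors.  The remaining
    formulas come from H (H (D_t)) ([squared_vt]).

    Differential equation.  The D_(y^j)-coefficient of m (D_t) is y^i H_i^j + H^j.
    Along a lifted curve y^i = D^al x^i / Gamma (1 + al), so multiplying
    D^al y^j = y^i H_i^j + H^j by Gamma (1 + al) gives the stated equation and is
    reversible ([integral_curveE]).  The constant passes through D^al because the
    kernels are integrable near the point ([frac_derivableZ]). *)

(** * Modules with a basis indexed by the variables t, x, y *)

Section Frames.
Context (A : comPzRingType) (V : lmodType A) (n : nat) (D : var n -> V).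
Implicit Types (g h : var n -> A) (f : A) (p q : 'I_n -> A).

Definition combination g : V := \sum_k g k *: D k.

Definition coefs f p q (k : var n) : A :=
  match k with None => f | Some (inl i) => p i | Some (inr i) => q i end.

Lemma sum_var (U : nmodType) (F : var n -> U) :
  \sum_k F k = F vt + \sum_i F (vx i) + \sum_i F (vy i).
Proof.
rewrite (bigD1 vt) //= -addrA; congr (_ + _).
rewrite (reindex_omap Some id) /=; last by case.
under eq_bigl do rewrite eqxx.
by rewrite big_sumType.
Qed.

Lemma combination_coefs f p q : combination (coefs f p q) =
  f *: D vt + \sum_i p i *: D (vx i) + \sum_i q i *: D (vy i).
Proof. by rewrite /combination sum_var. Qed.

(** Values of theta1 and theta2 have this shape. *)
Lemma combination_horizontal f p :
  combination (coefs f p (fun=> 0)) = f *: D vt + \sum_i p i *: D (vx i).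
Proof.
rewrite combination_coefs [X in _ + X]big1 => [|i _]; last exact: scale0r.
exact: addr0.
Qed.

Lemma combinationD g h : combination (fun k => g k + h k) = combination g + combination h.
Proof. by rewrite -big_split; apply: eq_bigr => k _; exact: scalerDl. Qed.

Lemma combinationZ f g : combination (fun k => f * g k) = f *: combination g.
Proof. by rewrite scaler_sumr; apply: eq_bigr => k _; rewrite scalerA. Qed.

Lemma combination0 : combination (fun=> 0) = 0.
Proof. by apply: big1 => k _; exact: scale0r. Qed.

Definition unit_coef (k j : var n) : A := (k == j)%:R.

Lemma combination_unit k : combination (unit_coef k) = D k.
Proof.
rewrite /combination (bigD1 k) //= /unit_coef eqxx scale1r.
rewrite big1 ?addr0 // => j jk.
by rewrite eq_sym (negbTE jk) scale0r.
Qed.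

Definition span (S : set A) : set V :=
  [set X | exists2 g, (forall k, S (g k)) & X = combination g].

Record subring (S : set A) : Prop := Subring {
  subring0 : S 0;
  subring1 : S 1;
  subringN : forall f, S f -> S (- f);
  subringD : forall f f', S f -> S f' -> S (f + f');
  subringM : forall f f', S f -> S f' -> S (f * f') }.

(** The values on the basis that the three axioms of a dynamical connection force
    on [H]; [H0] and [H1] are the only freedom left. Everything that is claimed
    about the connection is a consequence of this record, so it is derived in an
    arbitrary module with a family indexed by the variables; linear independence
    of that family enters only when the record is established. [H] is linear only
    over [S] and on the [S]-span, since nothing else is known of it. *)
Record connection_frame (S : set A) (y : 'I_n -> A) (H : V -> V)
    (H0 : 'I_n -> A) (H1 : 'I_n -> 'I_n -> A) : Prop := ConnectionFrame {
  frame_subring : subring S;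
  frame_y : forall i, S (y i);
  frame_H0 : forall j, S (H0 j);
  frame_H1 : forall i j, S (H1 i j);
  frame_linear : forall f X Y, S f -> span S X -> span S Y ->
    H (f *: X + Y) = f *: H X + H Y;
  frame_vt : H (D vt) = - (\sum_i y i *: D (vx i)) + \sum_j H0 j *: D (vy j);
  frame_vx : forall i, H (D (vx i)) = D (vx i) + \sum_j H1 i j *: D (vy j);
  frame_vy : forall i, H (D (vy i)) = - D (vy i) }.

Section Subring.
Variable S : set A.
Hypothesis S_ring : subring S.
Local Notation span := (span S).

Let S0 := subring0 S_ring.
Let S1 := subring1 S_ring.
Let SD := subringD S_ring.

Lemma subringB f f' : S f -> S f' -> S (f - f').
Proof. by move=> Sf Sf'; apply: SD => //; exact: subringN. Qed.

Lemma subring_sum (I : finType) (F : I -> A) : (forall i, S (F i)) -> S (\sum_i F i).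
Proof.
move=> SF; apply: big_ind => [|f f'|i _]; last exact: SF.
  exact: subring0.
exact: subringD.
Qed.

Lemma subring_unit_coef k j : S (unit_coef k j).
Proof. by rewrite /unit_coef; case: eqP. Qed.

Lemma span_comb g : (forall k, S (g k)) -> span (combination g).
Proof. by exists g. Qed.

Lemma span0 : span 0.
Proof. by exists (fun=> 0); rewrite ?combination0. Qed.

Lemma span_basis k : span (D k).
Proof. by exists (unit_coef k); [exact: subring_unit_coef|rewrite combination_unit]. Qed.

Lemma spanP f X Y : S f -> span X -> span Y -> span (f *: X + Y).
Proof.
move=> Sf [g Sg ->] [h Sh ->]; exists (fun k => f * g k + h k).
  by move=> k; apply: SD => //; exact: subringM.
by rewrite combinationD combinationZ.
Qed.

End Subring.

Section Connection.
Variables (S : set A) (y : 'I_n -> A) (H : V -> V).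
Variables (H0 : 'I_n -> A) (H1 : 'I_n -> 'I_n -> A).
Hypothesis frame : connection_frame S y H H0 H1.
Local Notation span := (span S).

Let S_ring := frame_subring frame.
Let HP := frame_linear frame.

Lemma connection0 : H 0 = 0.
Proof.
have := HP (subring1 S_ring) (span0 S_ring) (span0 S_ring).
by rewrite !scale1r addr0 => /esym/eqP; rewrite -subr_eq0 addrK => /eqP.
Qed.

Lemma connection_combination g : (forall k, S (g k)) ->
  H (combination g) = \sum_k g k *: H (D k).
Proof.
move=> Sg; rewrite /combination.
suff [] : span (\sum_k g k *: D k) /\
  H (\sum_k g k *: D k) = \sum_k g k *: H (D k) by [].
elim: (index_enum _) => [|k s [IHf IHH]].
  by rewrite !big_nil; split; [exact: span0|exact: connection0].
rewrite !big_cons; split; first by apply: spanP => //; exact: span_basis.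
by rewrite HP ?IHH //; exact: span_basis.
Qed.

(** The shape in which the connection is displayed in a chart. *)
Lemma connection_blocks g : (forall k, S (g k)) ->
  H (combination g) =
    \sum_i g vt *: (- (y i *: D (vx i)) + H0 i *: D (vy i))
    + \sum_i g (vx i) *: (D (vx i) + \sum_j H1 i j *: D (vy j))
    - \sum_i g (vy i) *: D (vy i).
Proof.
move=> Sg; rewrite (connection_combination Sg) sum_var (frame_vt frame).
congr (_ + _ + _).
- by rewrite -scaler_sumr big_split /= sumrN.
- by apply: eq_bigr => i _; rewrite (frame_vx frame).
- by rewrite -sumrN; apply: eq_bigr => i _; rewrite (frame_vy frame) scalerN.
Qed.

(** The matrix of [H] in the basis. Working on coefficient families reduces the
    powers of [H] to ring identities. *)
Definition connection_coefs g := coefs 0 (fun i => g (vx i) - y i * g vt)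
  (fun j => g vt * H0 j + \sum_i g (vx i) * H1 i j - g (vy j)).

Lemma subring_connection_coefs g :
  (forall k, S (g k)) -> forall k, S (connection_coefs g k).
Proof.
move=> Sg; have Sy := frame_y frame; have SH0 := frame_H0 frame.
have SH1 := frame_H1 frame; case=> [[i|j]|] /=; last exact: subring0.
  by apply: subringB => //; exact: subringM.
apply: subringB => //; apply: subringD; [by []|exact: subringM|].
by apply: subring_sum => // i; exact: subringM.
Qed.

Lemma connection_combinationE g : (forall k, S (g k)) ->
  H (combination g) = combination (connection_coefs g).
Proof.
move=> Sg; rewrite (connection_combination Sg) sum_var (frame_vt frame).
rewrite combination_coefs scale0r add0r.
under [\sum_i _ *: H (D (vx i))]eq_bigr do rewrite (frame_vx frame) scalerDr scaler_sumr.
under [\sum_i _ *: H (D (vy i))]eq_bigr do rewrite (frame_vy frame).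
rewrite [X in _ + X + _]big_split /= scalerDr scalerN !scaler_sumr -sumrN.
rewrite addrACA -big_split /= -addrA; congr (_ + _).
  by apply: eq_bigr => i _; rewrite scalerA addrC -scalerBl [y i * _]mulrC.
rewrite [X in _ + X + _]exchange_big /= -!big_split; apply: eq_bigr => j _ /=.
rewrite scalerBl scalerDl scaler_suml scalerN scalerA; congr (_ + _ - _).
by apply: eq_bigr => i _; rewrite scalerA.
Qed.

(** The vertical part of the equation of motion; it appears when [H] is applied
    twice to [D vt], because [H (D vx)] feeds back into the vertical part. *)
Definition spray_coef j := \sum_i y i * H1 i j + H0 j.

Lemma subring_spray k : S (coefs 1 y spray_coef k).
Proof.
have Sy := frame_y frame; have SH0 := frame_H0 frame.
have SH1 := frame_H1 frame; case: k => [[i|j]|] //=; last exact: subring1.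
by apply: subringD => //; apply: subring_sum => // i; exact: subringM.
Qed.

Definition squared_coefs g := coefs 0 (fun i => g (vx i) - y i * g vt)
  (fun j => g (vy j) - spray_coef j * g vt).

Lemma connection_squared g : (forall k, S (g k)) ->
  H (H (combination g)) = combination (squared_coefs g).
Proof.
move=> Sg; rewrite (connection_combinationE Sg).
rewrite (connection_combinationE (subring_connection_coefs Sg)).
congr combination; apply/funext; case=> [[i|j]|] //=; first by rewrite mulr0 subr0.
rewrite /spray_coef mul0r add0r.
under eq_bigr do rewrite mulrBl.
rewrite sumrB mulrDl mulr_suml.
under [\sum_(i < n) (y i * g vt) * _]eq_bigr do rewrite mulrAC.
by ring.
Qed.

(** [H] kills the time component, and [H \o H] is the identity on combinations
    without time component. *)
Lemma connection_cubed X : span X -> H (H (H X)) = H X.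
Proof.
case=> g Sg ->; rewrite (connection_combinationE Sg).
rewrite (connection_squared (subring_connection_coefs Sg)).
by congr combination; apply/funext; case=> [[i|j]|] //=; rewrite mulr0 subr0.
Qed.

Lemma span_connection X : span X -> span (H X).
Proof.
case=> g Sg ->; rewrite (connection_combinationE Sg).
by apply: span_comb; exact: subring_connection_coefs.
Qed.

(** [m (m X)] is [- H (H (m X)) + m X], so this identity makes the complementary
    projector [m] idempotent. *)
Lemma connection_complement X : span X -> H (- H (H X) + X) = 0.
Proof.
move=> sX; rewrite -scaleN1r HP ?connection_cubed ?scaleN1r ?addNr //.
  by apply: subringN => //; exact: subring1.
by do 2 apply: span_connection.
Qed.

Lemma squared_vt : H (H (D vt)) =
  - (\sum_i y i *: D (vx i)) - \sum_j spray_coef j *: D (vy j).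
Proof.
rewrite -combination_unit (connection_squared (subring_unit_coef S_ring vt)).
rewrite combination_coefs scale0r add0r -!sumrN; congr (_ + _).
  by apply: eq_bigr => i _; rewrite /unit_coef /= mulr1 sub0r scaleNr.
by apply: eq_bigr => j _; rewrite /unit_coef /= mulr1 sub0r scaleNr.
Qed.

Lemma squared_basis k : k != vt -> H (H (D k)) = D k.
Proof.
move=> kt; rewrite -combination_unit (connection_squared (subring_unit_coef S_ring k)).
congr combination; apply/funext => -[[i|j]|] /=.
- by rewrite /unit_coef (negbTE kt) mulr0 subr0.
- by rewrite /unit_coef (negbTE kt) mulr0 subr0.
- by rewrite /unit_coef (negbTE kt).
Qed.

Lemma complement_vt : - H (H (D vt)) + D vt =
  D vt + \sum_i y i *: D (vx i) + \sum_j spray_coef j *: D (vy j).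
Proof. by rewrite squared_vt opprB opprK addrC [X in _ + X]addrC addrA. Qed.

Lemma complement_basis k : k != vt -> - H (H (D k)) + D k = 0.
Proof. by move=> kt; rewrite squared_basis // addNr. Qed.
End Connection.
End Frames.

(** * Powers and the gamma function *)

Section Powers.
Context {R : realType}.
Implicit Types (p a b t : R).
Local Notation mu := (@lebesgue_measure R).

Lemma is_derive_powR_primitive p t : -1 < p -> 0 < t ->
  is_derive t 1 (fun s => (p + 1)^-1 * s `^ (p + 1)) (t `^ p).
Proof.
move=> p1 t0; have p10 : p + 1 != 0 by rewrite gt_eqF//; lra.
apply: is_derive_eq; first by apply: is_deriveZ; exact: is_derive1_powR.
by rewrite addrK /GRing.scale /= mulKf.
Qed.

Lemma continuous_powR p t : 0 < t -> {for t, continuous (fun s : R => s `^ p)}.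
Proof.
move=> t0; apply: differentiable_continuous; apply/derivable1_diffP.
by have [] := is_derive1_powR p t0.
Qed.

Lemma integral_powR p a b : -1 < p -> 0 < a -> a < b ->
  (\int[mu]_(t in `[a, b]) (t `^ p)%:E =
   ((p + 1)^-1 * (b `^ (p + 1) - a `^ (p + 1)))%:E)%E.
Proof.
move=> p1 a0 ab.
have dF t (t0 : 0 < t) := is_derive_powR_primitive p1 t0.
have cF t : 0 < t -> {for t, continuous (fun s => (p + 1)^-1 * s `^ (p + 1))}.
  move=> t0; apply: differentiable_continuous; apply/derivable1_diffP.
  by have [] := dF t t0.
rewrite (@continuous_FTC2 _ _ (fun s => (p + 1)^-1 * s `^ (p + 1))) //.
- by rewrite -EFinB -mulrBr.
- apply: continuous_in_subspaceT => t; rewrite inE /= in_itv /= => /andP[at_ _].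
  by apply: continuous_powR; exact: lt_le_trans at_.
- split.
  + by move=> t; rewrite in_itv /= => /andP[at_ _]; have [] := dF t (lt_trans a0 at_).
  + by apply: cvg_at_right_filter; exact: cF.
  + by apply: cvg_at_left_filter; apply: cF; exact: lt_trans ab.
- move=> t; rewrite in_itv /= => /andP[at_ _]; rewrite derive1E.
  by have [_ ->] := dF t (lt_trans a0 at_).
Qed.

(** The fundamental theorem of calculus needs a continuous integrand on a closed
    interval, so the singularity at 0 is reached by monotone convergence along
    [1/(n+2), 1], where the integrals stay below 1/(p+1). *)
Lemma integrable_powR01 p : -1 < p ->
  mu.-integrable `]0, 1] (fun t => (t `^ p)%:E).
Proof.
move=> p1.
have mf (D : set R) : measurable_fun D (EFin \o (fun t : R => t `^ p)).
  by apply/measurable_EFinP; apply: measurable_funTS; exact: measurable_powR.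
apply/integrableP; split; first exact: mf.
under eq_integral do rewrite /= ger0_norm ?powR_ge0//.
pose F n : set R := `[n.+2%:R^-1, 1]%classic.
have -> : `]0, 1]%classic = \bigcup_n F n.
  apply/seteqP; split => [t | t [n _]]; rewrite /F /= !in_itv /=.
    move=> /andP[t0 t1].
    have [N _ /(_ N (leqnn N)) /= NP] := near_infty_natSinv_lt (PosNum t0).
    exists N => //; rewrite /F /= in_itv /= t1 andbT ltW //; apply: le_lt_trans NP => /=.
    by rewrite lef_pV2 ?posrE ?ltr0n // ler_nat.
  by move=> /andP[nt ->]; rewrite andbT; apply: lt_le_trans nt; rewrite invr_gt0 ltr0n.
have Fcvg := @ge0_nondecreasing_set_cvg_integral _ (measurableTypeR R) R F
  (fun t => (t `^ p)%:E) mu.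
have ndF : nondecreasing_seq F.
  move=> m k mk; rewrite subsetEset => t; rewrite /F /= !in_itv /= => /andP[mt ->].
  by rewrite andbT; apply: le_trans mt; rewrite lef_pV2 ?posrE ?ltr0n // ler_nat !ltnS.
have {}Fcvg := Fcvg ndF (fun n => measurable_itv _) (fun n => mf _)
  (fun n t _ => powR_ge0 _ _).
apply: (@le_lt_trans _ _ ((p + 1)^-1)%:E); last by rewrite ltry.
rewrite -(cvg_lim _ Fcvg) //; apply: lime_le; first by apply/cvg_ex; eexists; exact: Fcvg.
apply: nearW => n; rewrite /F integral_powR //; last by rewrite invf_lt1 ?ltr0n ?ltr1n.
rewrite lee_fin powR1 ger_pMr ?invr_gt0; last by lra.
by rewrite lerBlDr lerDl powR_ge0.
Qed.

(** On ]0, 1] the integrand is below t^(z-1). Beyond 1, z - 1 <= 1 gives the bound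
    t * exp (-t) <= 4 * (1/2 * exp (-t/2)), an exponential density. *)
Lemma integrable_Gamma (z : R) : 0 < z < 2 ->
  mu.-integrable `]0, +oo[ (EFin \o (fun t => t `^ (z - 1) * expR (- t))).
Proof.
move=> /andP[z0 z2]; have p1 : -1 < z - 1 by lra.
pose g t : R := ((fun s => s `^ (z - 1)) \_ `]0, 1]) t + 4 * exponential_pdf 2^-1 t.
have ig : mu.-integrable setT (EFin \o g).
  pose a := (fun s : R => s `^ (z - 1)) \_ `]0, 1].
  have -> : EFin \o g = ((EFin \o a) \+
      (fun t => 4%:E * (EFin \o exponential_pdf 2^-1) t))%E.
    by apply/funext => t; rewrite /= EFinD EFinM.
  apply: integrableD => //=.
    have := integrable_powR01 p1; rewrite integrable_mkcond //.
    by rewrite restrict_EFin.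
  apply: integrableZl => //; apply: integrable_exponential_pdf; lra.
apply: (@le_integrable _ _ _ mu _ _ _ (EFin \o g)) => //=.
- apply/measurable_EFinP; apply: measurable_funTS; apply: measurable_funM.
    exact: measurable_powR.
  by apply: measurableT_comp => //; exact: measurable_expR.
- move=> t; rewrite in_itv /= andbT => t0; rewrite lee_fin.
  rewrite ger0_norm ?mulr_ge0 ?powR_ge0 ?expR_ge0 //.
  apply: le_trans (ler_norm _); rewrite /g exponential_pdfE; last exact: ltW.
  rewrite patchE; case: ifPn => [|].
    rewrite inE /= in_itv /= => /andP[_ t1].
    rewrite -[leLHS]addr0; apply: lerD; last by rewrite !mulr_ge0 // ?expR_ge0.
    by rewrite ger_pMr ?powR_gt0 // -expR0 ler_expR; lra.
  rewrite notin_setE /= in_itv /= t0 /= => /negP; rewrite -ltNge => t1.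
  have tp : t `^ (z - 1) <= t.
    by apply: ler1_powR; lra.
  apply: (@le_trans _ _ (t * expR (- t))); first by rewrite ler_wpM2r // expR_ge0.
  rewrite add0r mulrA.
  have -> : - t = - 2^-1 * t + - 2^-1 * t by lra.
  rewrite expRD mulrA ler_wpM2r ?expR_ge0 //.
  (* exp (t/2) >= 1 + t/2 turns t * exp (-t/2) <= 2 into algebra. *)
  have : expR (- 2^-1 * t) * expR (2^-1 * t) = 1 by rewrite -expRD mulNr addNr expR0.
  have := expR_ge1Dx (2^-1 * t). 
  have := expR_gt0 (- 2^-1 * t).
  move: (expR _) (expR _) => x y; nra.
- by apply: integrableS ig.
Qed.

(** Finiteness matters as much as positivity of the integrand: the real-valued
    integral of a function with infinite integral is 0. *)
Lemma Gamma_gt0 (z : R) : 0 < z < 2 -> 0 < Gamma z.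
Proof.
move=> z02; have iG := integrable_Gamma z02.
(* c bounds the integrand from below on [1, 2]. *)
pose c : R := 2^-1 * expR (- 2).
have c0 : 0 < c by rewrite mulr_gt0 ?invr_gt0 ?expR_gt0.
rewrite -lte_fin /Gamma /Rintegral fineK; last exact: integrable_fin_num.
apply: (@lt_le_trans _ _ (\int[mu]_(t in `[1%R, 2%R]) c%:E)%E).
  rewrite integral_cst //= lebesgue_measure_itv /= lte_fin ltr1n.
  by rewrite -EFinB -EFinM lte_fin mulr_gt0 //; lra.
have f0 t : (0 <= (t `^ (z - 1) * expR (- t))%:E)%E.
  by rewrite lee_fin mulr_ge0 ?powR_ge0 ?expR_ge0.
have mf := measurable_int mu iG.
have sub : (`[1%R, 2%R]%classic : set R) `<=` `]0%R, +oo[%classic.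
  by move=> t /=; rewrite !in_itv /= andbT => /andP[t1 _]; lra.
apply: (@le_trans _ _ (\int[mu]_(t in `[1%R, 2%R]) (t `^ (z - 1) * expR (- t))%:E)%E).
  apply: ge0_le_integral => //=.
  - by move=> t _; rewrite lee_fin ltW.
  - exact: measurable_funS mf.
  - move=> t; rewrite in_itv /= => /andP[t1 t2]; rewrite lee_fin /c.
    rewrite ler_pM ?expR_ge0 ?ler_expR ?lerN2 //.
    apply: (@le_trans _ _ (t `^ (-1))).
      by rewrite powR_inv1 ?lef_pV2 ?posrE; lra.
    by apply: ler_powR => //; lra.
exact: ge0_subset_integral.
Qed.

Lemma Gamma_1D_neq0 (al : R) : 0 < al < 1 -> Gamma (1 + al) != 0.
Proof. by move=> /andP[al0 al1]; rewrite gt_eqF // Gamma_gt0 //; lra. Qed.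

Lemma Gamma_1B_neq0 (al : R) : 0 < al < 1 -> Gamma (1 - al) != 0.
Proof. by move=> /andP[al0 al1]; rewrite gt_eqF // Gamma_gt0 //; lra. Qed.
End Powers.

(** * Fractional derivatives of constants and of indicator functions *)

Section FractionalDerivatives.
Context {R : realType}.
Implicit Types (al a b c t e : R) (f : R -> R).
Local Notation mu := (@lebesgue_measure R).

(** The increments may be one-sided (when t = a), but always contain the positive
    ones, so limits along them are unique. *)
Lemma increments_at_right a t : a <= t -> increments a t `<=` 0^'+.
Proof.
move=> at_ A; rewrite /increments /within /= /dnbhs /at_right => -[e /= e0 h].
exists e => //= x xe x0; apply: h => //=; first by rewrite gt_eqF.
by rewrite (le_trans at_) // lerDl ltW.
Qed.

Lemma increments_proper a t : a <= t -> ProperFilter (increments a t).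
Proof.
move=> at_; apply: Build_ProperFilter_ex => A /(increments_at_right at_) A0.
exact: filter_ex A0.
Qed.

Lemma near_increments a t e : 0 < e ->
  \forall h \near increments a t, `|h| < e.
Proof. by move=> e0; apply: cvg_within; exact: (@dnbhs0_lt R R). Qed.

Lemma near_increments_lt a t e : 0 < e ->
  \forall h \near increments a t, t + h < t + e.
Proof.
move=> e0; have := @near_increments a t e e0; apply: filterS.
by move=> h /ltr_normlW; rewrite ltrD2l.
Qed.

Lemma fracD_constant al a t e f : a < t -> 0 < e ->
  (forall s, a <= s < t + e -> f s = f a) -> fracD al a f t = 0.
Proof.
move=> at_ e0 fa; have F := increments_proper (ltW at_).
rewrite /fracD (_ : lim _ = 0) ?mulr0 //; apply: cvg_lim => //.
have int0 u : u < t + e -> frac_integral al a f u = 0.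
  move=> ut; rewrite /frac_integral.
  rewrite (@eq_Rintegral _ _ _ mu _ (fun=> 0)) ?Rintegral_cst ?mul0r //.
  move=> s; rewrite inE /= in_itv /= => /andP[as_ su].
  by rewrite /frac_kernel fa ?subrr ?mul0r // as_ (le_lt_trans su).
apply: (@cvg_trans _ ((fun=> 0) @ increments a t)); last exact: cvg_cst.
apply: near_eq_cvg; near=> h.
rewrite /frac_quotient !int0 ?subrr ?mulr0 // ?ltrDl //.
by near: h; exact: near_increments_lt.
Unshelve. all: by end_near. Qed.

Lemma integral_kernel al b c t : 0 < al < 1 -> b < c -> c < t ->
  \int[mu]_(s in `[b, c]) ((t - s) `^ al)^-1 =
  (1 - al)^-1 * ((t - b) `^ (1 - al) - (t - c) `^ (1 - al)).
Proof.
move=> /andP[al0 al1] bc ct.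
pose P u := (- al + 1)^-1 * u `^ (- al + 1).
pose F s := - P (t - s).
have dF s : s < t -> is_derive s 1 F ((t - s) `^ al)^-1.
  move=> st; have ts : 0 < t - s by rewrite subr_gt0.
  have dP : is_derive (t - s) 1 P ((t - s) `^ - al).
    by apply: is_derive_powR_primitive => //; lra.
  have dB : is_derive s 1 (fun s => t - s) (-1).
    rewrite -[X in is_derive _ _ _ X]sub0r.
    exact: (is_deriveB (is_derive_cst t s 1) (is_derive_id s 1)).
  have -> : ((t - s) `^ al)^-1 = - ((t - s) `^ (- al) * -1).
    by rewrite powRN mulrN1 opprK.
  exact: (is_deriveN (@is_derive1_comp _ P (fun s => t - s) _ _ _ dP dB)).
have cF s : s < t -> {for s, continuous F}.
  move=> st; apply: differentiable_continuous; apply/derivable1_diffP.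
  by have [] := dF s st.
have ck s : s < t -> {for s, continuous (fun s => ((t - s) `^ al)^-1)}.
  move=> st; have ts : 0 < t - s by rewrite subr_gt0.
  apply: cvgV; first by rewrite gt_eqF // powR_gt0.
  apply: (@continuous_comp _ _ _ (fun s => t - s) (fun u => u `^ al)).
    by apply: cvgB; [exact: cvg_cst|exact: cvg_id].
  exact: continuous_powR.
rewrite /Rintegral (@continuous_FTC2 _ _ F) //.
- rewrite -EFinB /= /F /P [- al + 1]addrC; ring.
- apply: continuous_in_subspaceT => s; rewrite inE /= in_itv /= => /andP[_ sc].
  by apply: ck; exact: le_lt_trans ct.
- split.
  + by move=> s; rewrite in_itv /= => /andP[_ sc]; have [] := dF s (lt_trans sc ct).
  + by apply: cvg_at_right_filter; apply: cF; exact: lt_trans ct.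
  + by apply: cvg_at_left_filter; apply: cF.
- move=> s; rewrite in_itv /= => /andP[_ sc]; rewrite derive1E.
  by have [_ ->] := dF s (lt_trans sc ct).
Qed.

(** An indicator function supported in [b, c] with c < t keeps the singularity of
    the kernel, which sits at the upper bound of integration, away from the
    support; the fractional integral is then an explicit smooth function near t. *)
Lemma fracD_bump al a b c t e f : 0 < al < 1 -> a < b -> b < c -> c < t -> 0 < e ->
  (forall s, a <= s < t + e -> f s = ((b <= s <= c)%R)%:R) ->
  fracD al a f t =
  (Gamma (1 - al))^-1 * (t - b) `^ (- al) - (Gamma (1 - al))^-1 * (t - c) `^ (- al).
Proof.
move=> al01 ab bc ct e0 fE; have /andP[al0 al1] := al01.
have at_ : a < t by lra.
have F := increments_proper (ltW at_).
rewrite /fracD -mulrBr; congr (_ * _); apply: cvg_lim => //.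
pose G u := (1 - al)^-1 * ((u - b) `^ (1 - al) - (u - c) `^ (1 - al)).
have intG u : c < u -> u < t + e -> frac_integral al a f u = G u.
  move=> cu ut; rewrite /G -integral_kernel // /frac_integral.
  have -> : `[b, c]%classic = `[a, u] `&` `[b, c] :> set R.
    apply/seteqP; split => s /=; rewrite !in_itv /=; last by case.
    by move=> /andP[bs sc]; split; [lra|rewrite bs].
  rewrite Rintegral_mkcondr; apply: eq_Rintegral => s.
  rewrite inE /= in_itv /= => /andP[as_ su].
  have fa : f a = 0 by rewrite fE ?lexx ?(lt_trans at_) ?ltrDl // leNgt ab.
  rewrite /frac_kernel fa subr0 fE ?as_ ?(le_lt_trans su) // patchE mem_setE in_itv /=.
  by case: ifP; rewrite ?mul1r ?mul0r.
have dG : is_derive t 1 G ((t - b) `^ (- al) - (t - c) `^ (- al)).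
  have dd d : d < t ->
    is_derive t 1 (fun u => (1 - al)^-1 * (u - d) `^ (1 - al)) ((t - d) `^ - al).
    move=> dt; have td : 0 < t - d by rewrite subr_gt0.
    have dP := @is_derive_powR_primitive _ (- al) _ ltac:(lra) td.
    have dB : is_derive t 1 (fun u => u - d) 1.
      rewrite -[X in is_derive _ _ _ X]subr0.
      exact: (is_deriveB (is_derive_id t 1) (is_derive_cst d t 1)).
    rewrite -[X in is_derive _ _ _ X]mulr1 [1 - al]addrC.
    exact: (@is_derive1_comp _ (fun s => (- al + 1)^-1 * s `^ (- al + 1))
      (fun u => u - d)).
  have -> : G = (fun u => (1 - al)^-1 * (u - b) `^ (1 - al))
              - (fun u => (1 - al)^-1 * (u - c) `^ (1 - al)).
    by apply/funext => u; rewrite /G mulrBr.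
  by apply: is_deriveB; apply: dd => //; lra.
have cvgG : (fun h => h^-1 * (G (t + h) - G t)) @ increments a t -->
    (t - b) `^ (- al) - (t - c) `^ (- al).
  apply: cvg_within_filter.
  have [/cvg_ex [l Gl] <-] := dG; rewrite /derive.
  rewrite (cvg_lim _ Gl) //; apply: cvg_trans Gl; apply: near_eq_cvg.
  by apply: nearW => h; rewrite [t + h]addrC /GRing.scale /= mulr1.
apply: cvg_trans cvgG; apply: near_eq_cvg; near=> h.
have ch : c < t + h.
  have : `|h| < t - c by near: h; apply: near_increments; rewrite subr_gt0.
  move=> /ltr_normlP[]; lra.
have he : t + h < t + e by near: h; exact: near_increments_lt.
by rewrite /frac_quotient !intG // ltrDl.
Unshelve. all: by end_near. Qed.
End FractionalDerivatives.

(** * Independence of the fractional partial derivatives *)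

Section Independence.
Context {R : realType} {n : nat} {al : R} {M : manifold R n} {c : chart M}.
Implicit Types (f g : W al c -> R) (z : var n -> R).

Lemma at_coords_range z : coord_range al c z ->
  exists2 w : W al c, coords w = z & forall f, at_coords f z = f w.
Proof.
move=> [w _ wz]; rewrite /at_coords; case: pselect => [e|[]]; last by exists w.
by exists (projT1 (cid e)) => //; exact: (projT2 (cid e)).
Qed.

(** Together with [at_coords_range], this makes [at_coords] compatible with sums
    and products at every tuple, inside or outside the range. *)
Lemma at_coords_notin z f : ~ coord_range al c z -> at_coords f z = 0.
Proof.
move=> zN; rewrite /at_coords; case: pselect => // e; exfalso; apply: zN.
by case: e => w wz; exists w.
Qed.

Variable lo : var n -> W al c -> R.
Hypothesis lo_left : left_endpoints lo.
Hypothesis al01 : 0 < al < 1.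

(** Test functions for linear independence. Such a bump varies along a single
    coordinate line, and vector fields act on all functions of the chart, so no
    smoothness is required of it. *)
Definition bump k (b d : R) : W al c -> R := fun w => ((b <= coord k w <= d)%R)%:R.

Lemma at_coords_bump k b d j w : exists2 e, 0 < e &
  forall s, lo j w <= s < coord j w + e ->
  at_coords (bump k b d) (subst (coords w) j s) =
  ((b <= subst (coords w) j s k <= d)%R)%:R.
Proof.
have [_ [e e0 he]] := lo_left j w; exists e => // s /he /at_coords_range[w' w'E ->].
by rewrite /bump /coord w'E.
Qed.

Lemma partialD_bump_neq k b d j w : j != k -> partialD lo j (bump k b d) w = 0.
Proof.
move=> jk; have [loj _] := lo_left j w.
have [e e0 he] := at_coords_bump k b d j w.
apply: (@fracD_constant _ _ _ _ e) => // s ls.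
have ll : lo j w <= lo j w < coord j w + e.
  by rewrite lexx (lt_trans loj) // ltrDl.
by rewrite (he _ ls) (he _ ll) /subst eq_sym (negbTE jk).
Qed.

(** Any b < d strictly between the left endpoint and the coordinate of w will do,
    since s |-> s^(-al) is injective; the thirds of that interval are taken. *)
Lemma partialD_bump k w : exists b d, partialD lo k (bump k b d) w != 0.
Proof.
have [lok _] := lo_left k w; have /andP[al0 al1] := al01.
pose r := coord k w - lo k w.
exists (lo k w + r / 3), (lo k w + r / 3 * 2).
set b := lo k w + _; set d := lo k w + _.
have [e e0 he] := at_coords_bump k b d k w.
have lob : lo k w < b by rewrite /b /r; lra.
have bd : b < d by rewrite /b /d /r; lra.
have dk : d < coord k w by rewrite /d /r; lra.
rewrite /partialD (@fracD_bump _ al _ b d _ e) //; last first.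
  by move=> s /he ->; rewrite /subst eqxx.
rewrite -mulrBr mulf_neq0 ?invr_eq0 //.
  exact: Gamma_1B_neq0.
rewrite subr_eq0 !powRN; apply/eqP => /invr_inj E.
have := gt0_ltr_powR al0 (x := coord k w - d) (y := coord k w - b).
rewrite E ltxx !nnegrE => /(_ _ _ _) F; suff : false by [].
by apply: F; rewrite /b /d /r; lra.
Qed.

Lemma lin_combE (g : var n -> W al c -> R) f w :
  lin_comb lo g f w = \sum_k g k w * partialD lo k f w.
Proof. by rewrite /lin_comb; elim/big_rec2: _ => // k x y _ <-. Qed.

(** Linear independence of the fractional partial derivatives: a bump in the k-th
    coordinate is seen only by the k-th of them, and it is not annihilated. *)
Lemma lin_comb_inj : injective (lin_comb lo).
Proof.
move=> g h gh; apply/funext => k; apply/funext => w.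
have [b [d D0]] := partialD_bump k w.
have coefE (p : var n -> W al c -> R) :
    lin_comb lo p (bump k b d) w = p k w * partialD lo k (bump k b d) w.
  rewrite lin_combE (bigD1 k) //= big1 ?addr0 // => j jk.
  by rewrite partialD_bump_neq // mulr0.
apply: (mulIf D0); by rewrite -!coefE gh.
Qed.
End Independence.

(** * Dynamical connections in the basis *)

Section DynamicalConnection.
Context {R : realType} {n : nat} {al : R} {M : manifold R n} {c : chart M}.
Variables (lo : var n -> W al c -> R) (S : set (W al c -> R)).
Hypotheses (al01 : 0 < al < 1) (lo_left : left_endpoints lo).
Hypothesis S_alg : function_algebra S.
Local Notation D := (partialD lo).
Local Notation y i := (coord (vy i)).
Implicit Types (X : operator al c) (f : W al c -> R).

Lemma function_algebra_subring : subring S.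
Proof.
have [Scst SD SM _] := S_alg; split=> //; [exact: Scst 0|exact: Scst 1|].
by move=> f Sf; rewrite -mulN1r; apply: SM => //; exact: Scst (-1).
Qed.

(** Independence is what turns the choice made in [component] into the coordinate
    function. *)
Lemma component_combination (g : var n -> W al c -> R) k :
  component lo k (combination D g) = g k.
Proof.
rewrite /component; case: xgetP => [h _ | /(_ g) []//].
by move/(lin_comb_inj lo_left al01) ->.
Qed.

Lemma field_component X : frac_fields lo S X ->
  X = combination D (component lo ^~ X) /\ forall k, S (component lo k X).
Proof.
case=> g Sg ->; split=> [|k]; last by rewrite component_combination.
by congr combination; apply/funext => k; rewrite component_combination.
Qed.

Lemma component_basis k j : component lo k (D j) = unit_coef _ j k.
Proof. by rewrite -(combination_unit D j) component_combination. Qed.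

Lemma GammaK f : cst (Gamma (1 + al))^-1 * (cst (Gamma (1 + al)) * f) = f.
Proof.
by apply/funext => w; rewrite !fctE mulKf // Gamma_1D_neq0.
Qed.

Lemma thetaE i X :
  theta lo i X = component lo (vx i) X - y i * component lo vt X.
Proof. by rewrite /theta /d_form [y i * _]mulrCA -mulrBr GammaK. Qed.

Lemma sum_tensorE (I : finType) (F : I -> operator al c -> operator al c) X :
  (\sum_i F i) X = \sum_i F i X.
Proof. by elim/big_rec2: _ => // i G1 G2 _ <-. Qed.

Variable H : operator al c -> operator al c.
Hypothesis H_conn : dynamical_connection_on lo S H.

Lemma connection_fields X : frac_fields lo S X -> frac_fields lo S (H X).
Proof. by case: H_conn => -[+ _] _ _ _; apply. Qed.

(** First axiom: theta1 (H X) is a multiple of a combination whose coefficient at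
    [D vt] is 1, so the multiplier vanishes. *)
Lemma connection_component_t X : frac_fields lo S X -> component lo vt (H X) = 0.
Proof.
move=> fX; case: H_conn => _ /(_ _ fX) + _ _.
set a := d_form lo vt (H X) => theta1_0.
have : lin_comb lo (coefs a (fun i => a * y i) (fun=> 0)) =
       lin_comb lo (fun=> 0).
  transitivity (theta1 lo (H X)); last first.
    by rewrite [LHS]theta1_0; exact/esym/(combination0 D).
  rewrite [LHS]combination_horizontal /theta1 /tensor -/a scalerDr scaler_sumr.
  by congr (_ + _); apply: eq_bigr => i _; rewrite scalerA.
move/(lin_comb_inj lo_left al01)/(congr1 (@^~ vt)) => /= a0.
by rewrite -[LHS]GammaK -[_ * component _ _ _]/a a0 mulr0.
Qed.

(** Second axiom, read off coefficientwise; the term y^i dt(H X) of theta^i (H X)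
    vanishes by the first one. *)
Lemma connection_component_x i X : frac_fields lo S X ->
  component lo (vx i) (H X) =
  component lo (vx i) X - y i * component lo vt X.
Proof.
move=> fX; case: H_conn => _ _ /(_ _ fX) + _.
rewrite /theta2 /= !sum_tensorE => thetaH.
have : lin_comb lo (coefs 0 (fun i => theta lo i (H X)) (fun=> 0)) =
       lin_comb lo (coefs 0 (fun i => theta lo i X) (fun=> 0)).
  rewrite [LHS]combination_horizontal [RHS]combination_horizontal.
  by congr (_ + _).
move/(lin_comb_inj lo_left al01)/(congr1 (@^~ (vx i))) => /=.
by rewrite !thetaE connection_component_t // mulr0 subr0.
Qed.

(** The unknown functions of the connection: [vertical_coef vt] is H^j and
    [vertical_coef (vx i)] is H_i^j. *)
Definition vertical_coef k j : W al c -> R := component lo (vy j) (H (D k)).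

Lemma connection_basis k : H (D k) =
  combination D (coefs 0 (fun i => unit_coef _ k (vx i) - y i * unit_coef _ k vt)
    (vertical_coef k)).
Proof.
have fD := span_basis D function_algebra_subring k.
have [-> _] := field_component (connection_fields fD).
congr combination; apply/funext; case=> [[i|j]|] //=.
  by rewrite connection_component_x // !component_basis.
by rewrite connection_component_t.
Qed.

(** The bridge from the tensorial axioms to the values on the basis: the axioms
    determine the components along t and x^i, and the third one the values on the
    vertical fields. *)
Lemma dynamical_connection_frame :
  connection_frame D S (fun i => y i) H (vertical_coef vt)
    (fun i => vertical_coef (vx i)).
Proof.
have SD k := span_basis D function_algebra_subring k.
have Sv k j : S (vertical_coef k j).
  by have [_] := field_component (connection_fields (SD k)); apply.
have [_ _ _ Sy] := S_alg; split => //.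
- exact: function_algebra_subring.
- by move=> f X Y Sf fX fY; case: H_conn => -[_ +] _ _ _; apply.
- rewrite connection_basis combination_coefs scale0r add0r; congr (_ + _).
  rewrite -sumrN; apply: eq_bigr => i _.
  by rewrite /unit_coef /= mulr1 sub0r scaleNr.
- move=> i; rewrite connection_basis combination_coefs scale0r add0r; congr (_ + _).
  rewrite (bigD1 i) //= big1 ?addr0 => [|k ki]; rewrite /unit_coef mulr0 subr0.
    by rewrite eqxx scale1r.
  have -> : (vx i == vx k) = false by rewrite eq_sym; exact: negbTE.
  exact: scale0r.
- move=> j; have [_ _ _] := H_conn; apply.
  exists (fun i => (i == j)%:R).
    move=> i; case: eqP => _; first exact: subring1 function_algebra_subring.
    exact: subring0 function_algebra_subring.
  rewrite (bigD1 j) //= eqxx scale1r big1 ?addr0 // => i ij.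
  by rewrite (negbTE ij) scale0r.
Qed.
End DynamicalConnection.

Section NormalForm.
Context {R : realType} {n : nat} {al : R} {M : manifold R n} {c : chart M}.
Variables (lo : var n -> W al c -> R) (S : set (W al c -> R)).
Hypotheses (al01 : 0 < al < 1) (lo_left : left_endpoints lo).
Hypothesis S_alg : function_algebra S.
Variable H : operator al c -> operator al c.
Hypothesis H_conn : dynamical_connection_on lo S H.
Local Notation D := (partialD lo).
Local Notation d := (d_form lo).
Local Notation y i := (coord (vy i)).
Local Notation H0 := (vertical_coef lo H vt).
Local Notation H1 i := (vertical_coef lo H (vx i)).

Let frame := dynamical_connection_frame al01 lo_left S_alg H_conn.

Lemma connection_normal_form : eq_tensor lo S H
  ((cst (Gamma (1 + al))^-1 : W al c -> R) *:
       (\sum_i tensor (d vt) (- (y i *: D (vx i)) + H0 i *: D (vy i))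
        + \sum_i tensor (d (vx i)) (D (vx i) + \sum_j H1 i j *: D (vy j))
        - \sum_i tensor (d (vy i)) (D (vy i)))).
Proof.
move=> X fX; have [XE SX] := field_component al01 lo_left fX.
transitivity (cst (Gamma (1 + al))^-1 *:
  (\sum_i d vt X *: (- (y i *: D (vx i)) + H0 i *: D (vy i))
   + \sum_i d (vx i) X *: (D (vx i) + \sum_j H1 i j *: D (vy j))
   - \sum_i d (vy i) X *: D (vy i))); last first.
  by congr (_ *: (_ + _ - _)); exact/esym/sum_tensorE.
have dZ k Z : cst (Gamma (1 + al))^-1 *: (d k X *: Z) = component lo k X *: Z.
  by rewrite scalerA GammaK.
rewrite scalerBr scalerDr !scaler_sumr.
under [\sum_i _ *: (d vt X *: _)]eq_bigr do rewrite dZ.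
under [\sum_i _ *: (d (vx i) X *: _)]eq_bigr do rewrite dZ.
under [\sum_i _ *: (d (vy i) X *: _)]eq_bigr do rewrite dZ.
rewrite [in LHS]XE; exact: connection_blocks frame _ SX.
Qed.

End NormalForm.

(** * Scalar multiples and integral curves *)

Section Scaling.
Context {R : realType}.
Implicit Types (al a t k : R) (f : R -> R).

Lemma frac_kernelZ al a t k f :
  frac_kernel al a (fun s => k * f s) t = fun s => k * frac_kernel al a f t s.
Proof. by apply/funext => s; rewrite /frac_kernel -mulrBr mulrA. Qed.

Lemma near_increments_right a t (P : R -> Prop) :
  (\forall u \near t, a <= u -> P u) -> \forall h \near increments a t, P (t + h).
Proof.
move=> Pt; rewrite /increments near_withinE; apply: cvg_within.
exact: (nbhs0P [set u | a <= u -> P u] t).1 Pt.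
Qed.

Lemma frac_quotientZ al a t k f : a <= t -> frac_derivable al a f t ->
  \forall h \near increments a t,
    k * frac_quotient al a f t h = frac_quotient al a (fun s => k * f s) t h.
Proof.
move=> at_ [int_f _].
have intZ u : lebesgue_measure.-integrable `[a, u] (EFin \o frac_kernel al a f u) ->
    frac_integral al a (fun s => k * f s) u = k * frac_integral al a f u.
  by move=> iu; rewrite /frac_integral frac_kernelZ RintegralZl.
apply: filterS (near_increments_right int_f) => h ih.
rewrite /frac_quotient !intZ //; last by apply: (nbhs_singleton int_f).
by rewrite -mulrBr mulrCA.
Qed.

(** Pulling the constant out of the integral requires integrability of the kernel,
    which fractional differentiability supplies at t and at all nearby points of
    the interval. *)
Lemma frac_derivableZ al a t k f : a <= t -> frac_derivable al a f t ->
  frac_derivable al a (fun s => k * f s) t /\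
  fracD al a (fun s => k * f s) t = k * fracD al a f t.
Proof.
move=> at_ df; have [int_f cvg_f] := df; have F := increments_proper at_.
have cvgZ : frac_quotient al a (fun s => k * f s) t @ increments a t -->
    k * lim (frac_quotient al a f t @ increments a t).
  apply: cvg_trans (cvgMl_tmp (a := k) cvg_f).
  exact: near_eq_cvg (frac_quotientZ k at_ df).
split; last by rewrite /fracD (cvg_lim _ cvgZ) // mulrCA.
split; last by apply/cvg_ex; eexists; exact: cvgZ.
apply: filterS int_f => u iu au; rewrite frac_kernelZ.
rewrite (_ : _ \o _ = (fun s => k%:E * (EFin \o frac_kernel al a f u) s)%E).
  by apply: integrableZl => //; exact: iu.
by apply/funext => s; rewrite /= EFinM.
Qed.

Lemma frac_derivableZE al a t k f : a <= t -> k != 0 ->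
  frac_derivable al a (fun s => k * f s) t <-> frac_derivable al a f t.
Proof.
move=> at_ k0; split=> [/(frac_derivableZ k^-1 at_)[]|/(frac_derivableZ k at_)[]//].
by rewrite (_ : (fun s => _) = f) //; apply/funext => s; rewrite mulKf.
Qed.
End Scaling.

Section IntegralCurves.
Context {R : realType} {n : nat} {al : R} {M : manifold R n} {c : chart M}.
Variables (lo : var n -> W al c -> R) (X : operator al c).
Variables (H0 : 'I_n -> W al c -> R) (H1 : 'I_n -> 'I_n -> W al c -> R).
Hypothesis al01 : 0 < al < 1.
Hypothesis X_vy : forall j, component lo (vy j) X =
  spray_coef (fun i => coord (vy i)) H0 H1 j.

(** At a lifted point the coordinate y^i is D^al x^i / Gamma (1 + al), which turns
    the vertical component of the field into the right-hand side of the equation.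
    If the lifted point lies outside the coordinate range, both sides are 0. *)
Lemma at_coords_spray a (x : R -> 'rV[R]_n) t j :
  Gamma (1 + al) * at_coords (component lo (vy j) X) (lift_point al a x t) =
  \sum_i fracD al a (xcomp x i) t * at_coords (H1 i j) (lift_point al a x t)
  + Gamma (1 + al) * at_coords (H0 j) (lift_point al a x t).
Proof.
have G0 : Gamma (1 + al) != 0 by exact: Gamma_1D_neq0.
have [zW|zW] := pselect (coord_range al c (lift_point al a x t)); last first.
  rewrite !at_coords_notin // mulr0 addr0 big1 // => i _.
  by rewrite at_coords_notin // mulr0.
have [w wz atE] := at_coords_range zW; rewrite X_vy !atE /spray_coef !fctE.
rewrite mulrDr; congr (_ + _).
rewrite fct_sumE mulr_sumr; apply: eq_bigr => i _; rewrite atE !fctE mulrA.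
by congr (_ * _); rewrite /coord wz /= mxE /ycomp mulVKf.
Qed.

(** D^al y^j is D^al (D^al x^j) divided by Gamma (1 + al), so the two systems
    differ by a nonzero factor. *)
Lemma integral_curveE (a : R) (b : \bar R) (x : R -> 'rV[R]_n) :
  integral_curve a b x lo X <-> equation_solution a b x H0 H1.
Proof.
have G0 : Gamma (1 + al) != 0 by exact: Gamma_1D_neq0.
have ZE t j := @frac_derivableZE _ al a t (Gamma (1 + al))^-1 (fracD al a (xcomp x j)).
have fracDy t j := @frac_derivableZ _ al a t (Gamma (1 + al))^-1 (fracD al a (xcomp x j)).
split=> -[xU sol]; split=> // t at_ tb j; have [dx] := sol t at_ tb j.
  move=> /(ZE t j at_ (invr_neq0 G0)) ddx; have [_ fDy] := fracDy t j at_ ddx.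
  by rewrite [fracD _ _ _ _]fDy => e; split=> //; rewrite -at_coords_spray -e mulVKf.
move=> ddx; have [dy fDy] := fracDy t j at_ ddx.
by rewrite -at_coords_spray => e; split=> //; rewrite [LHS]fDy e mulKf.
Qed.
End IntegralCurves.

(** * The projectors and the FODE of a connection *)

Theorem proposition4 (R : realType) (n : nat) (al : R) (al01 : 0 < al < 1)
    (M : manifold R n)
    (lo : forall c : chart M, var n -> W al c -> R)
    (lo_left : forall c, left_endpoints (lo c))
    (S : forall c : chart M, set (W al c -> R))
    (S_alg : forall c, function_algebra (S c))
    (H : forall c : chart M, operator al c -> operator al c)
    (H_conn : dynamical_connection lo S H)
    (U : chart M) :
  let D := partialD (lo U) in
  let d := d_form (lo U) in
  let y i := coord (vy i) in
  let teq := eq_tensor (lo U) (S U) in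
  let l := H U \o H U in
  let m := - (H U \o H U) + id in
  f31_structure lo S H /\
  exists (H0 : 'I_n -> W al U -> R) (H1 : 'I_n -> 'I_n -> W al U -> R),
    (forall j, S U (H0 j)) /\ (forall i j, S U (H1 i j)) /\
    teq (H U)
      ((cst (Gamma (1 + al))^-1 : W al U -> R) *:
       (\sum_i tensor (d vt) (- (y i *: D (vx i)) + H0 i *: D (vy i))
        + \sum_i tensor (d (vx i)) (D (vx i) + \sum_j H1 i j *: D (vy j))
        - \sum_i tensor (d (vy i)) (D (vy i)))) /\
    [/\ teq (l \o l) l, teq (m \o m) m, teq (m \o l) 0 & teq (l + m) id] /\
    [/\ l (D vt) = - (\sum_i y i *: D (vx i))
                   - \sum_j (\sum_i y i * H1 i j + H0 j) *: D (vy j),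
        forall i, l (D (vx i)) = D (vx i) &
        forall i, l (D (vy i)) = D (vy i)] /\
    [/\ m (D vt) = D vt + \sum_i y i *: D (vx i)
                   + \sum_j (\sum_i y i * H1 i j + H0 j) *: D (vy j),
        forall i, m (D (vx i)) = 0 &
        forall i, m (D (vy i)) = 0] /\
    FODE (lo U) (S U) (m (D vt)) /\
    (forall (a : R) (b : \bar R) (x : R -> 'rV[R]_n), (a%:E < b)%E ->
       integral_curve a b x (lo U) (m (D vt)) <->
       equation_solution a b x H0 H1).
Proof.
move=> D d y teq l m; split.
  move=> c; have [tH _ _ _] := H_conn c; split=> // X fX.
  have frame := dynamical_connection_frame al01 (lo_left c) (S_alg c) (H_conn c).
  exact: (connection_cubed frame).
have frame := dynamical_connection_frame al01 (lo_left U) (S_alg U) (H_conn U).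
set H0 := vertical_coef _ _ vt in frame.
set H1 := fun i => vertical_coef _ _ (vx i) in frame.
have GE : m (D vt) = combination D (coefs 1 y (spray_coef y H0 H1)).
  by rewrite [LHS](complement_vt frame) combination_coefs scale1r.
exists H0, H1; split; first exact: frame_H0 frame.
split; first exact: frame_H1 frame.
split; first exact: connection_normal_form.
split.
  split=> X fX.
  - by rewrite /l /= [LHS](connection_cubed frame) //; exact: (span_connection frame).
  (* Both m (m X) and m (l X) unfold to - H (H Y) + Y with H Y known. *)
  - rewrite [LHS](congr1 (fun Z => - H U Z + m X) (connection_complement frame fX)).
    by rewrite (connection0 frame) oppr0 add0r.
  - rewrite [LHS](congr1 (fun Z => - H U Z + l X) (connection_cubed frame fX)).
    exact: addNr.
  - exact: addNKr.
split.
  split.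
  - exact: squared_vt frame.
  - by move=> i; exact: (squared_basis frame).
  - by move=> i; exact: (squared_basis frame).
split.
  split.
  - exact: complement_vt frame.
  - by move=> i; exact: (complement_basis frame).
  - by move=> i; exact: (complement_basis frame).
split.
  rewrite GE; split.
  - exists (coefs 1 y (spray_coef y H0 H1)) => //.
    exact: subring_spray frame.
  - by rewrite /d_form GammaK // component_combination.
  - by move=> i; rewrite thetaE // !component_combination //= mulr1 subrr.
move=> a b x _; apply: (integral_curveE al01) => j.
by rewrite GE component_combination.
Qed.
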